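(* Let $G$ be a connected complex reductive group and let $\mathcal{F}$ be a countable subset of $\mathcal{H}(G)$. Then for any maximal compact subgroup $K$ of $G$ there exists a $K$-admissible measure $d\mu$ on $G$ such that for all $g_1,g_2\in G$ and all $f\in\mathcal{F}$ we have $R_{g_1}L_{g_2}f\in\mathcal{H}L^2(G,d\mu)$. In particular, $\mathcal{F}\subset\mathcal{H}L^2(G,d\mu)$.
   Context: A complex Lie group $G$ is reductive if it admits a faithful finite-dimensional holomorphic representation and every finite-dimensional holomorphic representation of $G$ is completely reducible. $\mathcal{H}(G)$ is the space of holomorphic functions on $G$. For $g\in G$, $(R_gf)(h)=f(hg)$ and $(L_gf)(h)=f(g^{-1}h)$. A measure $d\mu$ on $G$ is tame if $d\mu=\mu\,dg$, where $dg$ is a left Haar measure and $\mu$ is a (nonnegative) measurable function on $G$ locally bounded from below: for every $x\in G$ there are $\delta>0$ and a neighborhood $U$ of $x$ such that $\mu(y)\ge\delta$ for almost all $y\in U$. For a tame measure, $\mathcal{H}L^2(G,d\mu)$ is the space of functions in $\mathcal{H}(G)$ that are square-integrable with respect to $d\mu$. Let $K$ be a maximal compact subgroup of $G$, and let $\widehat{G}_{\mathcal{H}}$ be the set of equivalence classes of finite-dimensional irreducible holomorphic representations of $G$. For each such representation $\pi$ on $V_\pi$, fix an inner product on $V_\pi$ for which $\pi|_K$ is unitary, and put $\|A\|^2=\mathrm{tr}(AA^* )$ and $C_{\pi,\mu}=\int_G\|\pi(g)\|^2\,d\mu(g)$. A tame measure $d\mu$ is $K$-admissible if it is $K$-bi-invariant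 (invariant under left and right translations by elements of $K$) and $C_{\pi,\mu}<+\infty$ for every $[\pi]\in\widehat{G}_{\mathcal{H}}$. *)

(* Defs.v *)
From HB Require Import structures.
From mathcomp Require Import all_boot all_order all_algebra.
From mathcomp Require Import monoid complex.
From mathcomp Require Import all_classical all_reals all_analysis.
From mathcomp Require Import spectral.

Set Implicit Arguments.
Unset Strict Implicit.
Unset Printing Implicit Defensive.

Import Order.TTheory GRing.Theory Num.Theory.
Import numFieldNormedType.Exports.

Local Open Scope classical_set_scope.
Local Open Scope ring_scope.
Local Open Scope complex_scope.
Local Open Scope sesquilinear_scope.

(* The complex numbers are R[i]^o: the suffix ^o is what gives R[i] its        *)
(* topology and its normed structure.  As the scalars are R[i],                *)
(* [differentiable] is complex Frechet differentiability, so that a map is     *)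
(* holomorphic on an open set when it is [differentiable] at each of its       *)
(* points.                                                                     *)

Section Charts.
Context (R : realType) (T : topologicalType) (n : nat).

(* A homeomorphism from an open subset of T onto an open subset of C^n.  Both  *)
(* maps are total; their values outside the two open sets are irrelevant.      *)
Record chart := Chart {
  chart_dom : set T;
  chart_fun : T -> 'rV[R[i]^o]_n;
  chart_inv : 'rV[R[i]^o]_n -> T;
  chart_dom_open : open chart_dom;
  chart_img_open : open (chart_fun @` chart_dom);
  chart_funK : {in chart_dom, cancel chart_fun chart_inv};
  chart_fun_continuous : {in chart_dom, continuous chart_fun};
  chart_inv_continuous : {in chart_fun @` chart_dom, continuous chart_inv}
}.

End Charts.

(* [point] of the pointed structure is an arbitrary element; it is only there  *)
(* because measurable types are pointed.                                       *)
HB.mixin Record isComplexLieGroup (R : realType) G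
    of Group G & PointedTopological G := {
  cdim : nat;
  atlas : set (chart R G cdim);
  lie_hausdorff : hausdorff_space G;
  lie_second_countable : @second_countable G;
  atlas_cover : forall x : G, exists2 c, atlas c & chart_dom c x;
  atlas_compatible : forall c c', atlas c -> atlas c' ->
    forall x : G, chart_dom c x -> chart_dom c' x ->
    differentiable (chart_fun c' \o chart_inv c) (chart_fun c x);
  lie_mul_continuous : continuous (fun p : G * G => (p.1 * p.2)%g);
  lie_mul_holomorphic : forall c1 c2 c3, atlas c1 -> atlas c2 -> atlas c3 ->
    forall x y : G, chart_dom c1 x -> chart_dom c2 y -> chart_dom c3 (x * y)%g ->
    differentiable
      (fun p : 'rV[R[i]^o]_cdim * 'rV[R[i]^o]_cdim =>
         chart_fun c3 (chart_inv c1 p.1 * chart_inv c2 p.2)%g)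
      (chart_fun c1 x, chart_fun c2 y);
  lie_inv_continuous : continuous (fun x : G => (x^-1)%g);
  lie_inv_holomorphic : forall c1 c2, atlas c1 -> atlas c2 ->
    forall x : G, chart_dom c1 x -> chart_dom c2 (x^-1)%g ->
    differentiable
      (fun p : 'rV[R[i]^o]_cdim => chart_fun c2 ((chart_inv c1 p)^-1)%g)
      (chart_fun c1 x)
}.

#[short(type="complexLieGroupType")]
HB.structure Definition ComplexLieGroup (R : realType) :=
  {G of isComplexLieGroup R G & Group G & PointedTopological G}.

Section HolomorphicMaps.
Context (R : realType) (G : complexLieGroupType R).

Definition holomorphic (W : normedModType R[i]) (f : G -> W) : Prop :=
  forall c, @atlas R G c -> forall x, chart_dom c x ->
    differentiable (f \o chart_inv c) (chart_fun c x).

Definition hol_functions : set (G -> R[i]^o) :=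
  [set f | @holomorphic R[i]^o f].

Definition right_translate (g : G) (f : G -> R[i]^o) : G -> R[i]^o :=
  fun h => f (h * g)%g.

Definition left_translate (g : G) (f : G -> R[i]^o) : G -> R[i]^o :=
  fun h => f (g^-1 * h)%g.

End HolomorphicMaps.

(* Every finite-dimensional representation is equivalent to one on a space of  *)
(* column vectors C^n, on which matrices act on the left.                      *)
Section Representations.
Context (R : realType) (G : complexLieGroupType R).

Definition hol_representation (n : nat) (pi : G -> 'M[R[i]^o]_n) : Prop :=
  [/\ pi 1%g = 1%:M,
      forall x y, pi (x * y)%g = pi x *m pi y
    & holomorphic pi].

Definition invariant_subspace (n : nat) (pi : G -> 'M[R[i]^o]_n)
    (U : {vspace 'cV[R[i]^o]_n}) : Prop :=
  forall g v, v \in U -> pi g *m v \in U.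

Definition irreducible_representation (n : nat)
    (pi : G -> 'M[R[i]^o]_n) : Prop :=
  (0 < n)%N /\
  forall U, invariant_subspace pi U -> U = 0%VS \/ U = fullv.

Definition completely_reducible (n : nat) (pi : G -> 'M[R[i]^o]_n) : Prop :=
  forall U, invariant_subspace pi U ->
  exists W, [/\ invariant_subspace pi W,
                (U :&: W)%VS = 0%VS & (U + W)%VS = fullv].

End Representations.

Definition reductive (R : realType) (G : complexLieGroupType R) : Prop :=
  (exists (n : nat) (pi : G -> 'M[R[i]^o]_n),
     hol_representation pi /\ injective pi) /\
  (forall (n : nat) (pi : G -> 'M[R[i]^o]_n),
     hol_representation pi -> completely_reducible pi).

Section Subgroups.
Context (R : realType) (G : complexLieGroupType R).

Definition compact_subgroup (K : set G) : Prop :=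
  [/\ K 1%g, forall x y, K x -> K y -> K (x * y)%g,
      forall x, K x -> K (x^-1)%g & compact K].

Definition maximal_compact_subgroup (K : set G) : Prop :=
  compact_subgroup K /\
  forall K', compact_subgroup K' -> K `<=` K' -> K' = K.

End Subgroups.

(* An inner product on C^n is given by its Gram matrix H.                      *)
Section InnerProducts.
Context (R : realType) (n : nat).
Implicit Types (H A : 'M[R[i]^o]_n) (u v : 'cV[R[i]^o]_n).

Definition inner H u v : R[i]^o := (v ^t* *m H *m u) ord0 ord0.

(* In R[i], [0 < z] entails that z is real. *)
Definition inner_product H : Prop :=
  H ^t* = H /\ forall v, v != 0 -> 0 < inner H v v.

(* The solution B of: forall u v, inner H (A *m u) v = inner H u (B *m v). *)
Definition adjoint H A : 'M[R[i]^o]_n := invmx H *m A ^t* *m H.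

(* The trace is real and nonnegative, whence the harmless [complex.Re]. *)
Definition hs_norm2 H A : R := complex.Re (\tr (A *m adjoint H A)).

End InnerProducts.

Definition unitary_on (R : realType) (G : complexLieGroupType R) (K : set G)
    (n : nat) (H : 'M[R[i]^o]_n) (pi : G -> 'M[R[i]^o]_n) : Prop :=
  forall k, K k -> forall u v, inner H (pi k *m u) (pi k *m v) = inner H u v.

Notation borel G := (g_sigma_algebraType (@open G)).

Section Measures.
Context (R : realType) (G : complexLieGroupType R).
Local Open Scope ereal_scope.
Implicit Types (lambda m : {measure set (borel G) -> \bar R}) (K : set G).

(* Regularity is automatic: a Borel measure that is finite on compact sets is  *)
(* regular on a second countable locally compact Hausdorff space.              *)
Definition left_haar lambda : Prop :=
  [/\ lambda setT != 0,
      forall A : set (borel G), compact (A : set G) -> lambda A < +oo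
    & forall (g : G) (A : set (borel G)), measurable A ->
        lambda [set (g * a)%g | a in (A : set G)] = lambda A].

Definition locally_bounded_below lambda (mu : borel G -> R) : Prop :=
  forall x : G, exists delta : R, exists U : set G,
    [/\ (0 < delta)%R, nbhs x U
      & {ae lambda, forall y, U y -> (delta <= mu y)%R}].

Definition tame m : Prop :=
  exists lambda, left_haar lambda /\
  exists mu : borel G -> R,
    [/\ measurable_fun setT mu,
        forall x, (0 <= mu x)%R,
        locally_bounded_below lambda mu
      & forall A, measurable A -> m A = \int[lambda]_(x in A) (mu x)%:E].

Definition biinvariant K m : Prop :=
  forall (k : G) (A : set (borel G)), K k -> measurable A ->
    m [set (k * a)%g | a in (A : set G)] = m A /\
    m [set (a * k)%g | a in (A : set G)] = m A.

Definition hs_integral m (n : nat) (H : 'M[R[i]^o]_n)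
    (pi : G -> 'M[R[i]^o]_n) : \bar R :=
  \int[m]_g (hs_norm2 H (pi g))%:E.

(* By Schur's lemma the K-invariant inner product of an irreducible            *)
(* representation is unique up to a positive factor, which leaves [adjoint],   *)
(* hence [hs_integral], unchanged; neither does an equivalence of              *)
(* representations change it.  So quantifying over all of them amounts to      *)
(* fixing a choice.                                                            *)
Definition admissible K m : Prop :=
  [/\ tame m, biinvariant K m
    & forall (n : nat) (pi : G -> 'M[R[i]^o]_n) (H : 'M[R[i]^o]_n),
        hol_representation pi -> irreducible_representation pi ->
        inner_product H -> unitary_on K H pi ->
        hs_integral m H pi < +oo].

Definition HL2 m : set (G -> R[i]^o) :=
  [set f | hol_functions f /\
           \int[m]_x ((complex.Re `|f x|) ^+ 2)%:E < +oo].

End Measures.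

(* Main.v *)
Require Import Defs.
From HB Require Import structures.
From mathcomp Require Import all_boot all_order all_algebra.
From mathcomp Require Import monoid complex.
From mathcomp Require Import all_classical all_reals all_analysis.
From mathcomp Require Import finmap ring lra zify measurable_realfun spectral.

Set Implicit Arguments.
Unset Strict Implicit.
Unset Printing Implicit Defensive.
Import Order.TTheory GRing.Theory Num.Theory.
Import numFieldNormedType.Exports.
Local Open Scope classical_set_scope.
Local Open Scope ring_scope.
Local Open Scope sesquilinear_scope.

(* Let V be a compact neighbourhood of 1 containing K.  As G is connected, the
   powers V^n exhaust G, and so do the compact K-bi-invariant sets
   E_n = K V^n K, which lie in V^(n+2).  The measure has the density a_n on
   E_n \ E_(n-1) with respect to a Haar measure lambda.  Being multiplicative, a
   representation grows at most geometrically on the powers of V, so a single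
   factor 1 / n! in a_n makes all the integrals C_(pi, mu) finite at once,
   however many irreducible representations there are.  For an enumeration
   (f_j) of the functions, dividing a_n further by 1 + lambda(E_n) and by one
   plus the sum of the squared suprema of f_0, ..., f_n on V^(2n) takes care of
   all the translates, since g2^-1 E_n g1 lies in V^(2n) for n large enough.

   The Haar measure is obtained by Weil's construction: the ratios
   (A : U) / (V : U) of covering numbers converge along an ultrafilter of
   neighbourhoods U of 1 to a content on compact sets.  Taking only
   neighbourhoods U that are invariant under conjugation by K (these are
   arbitrarily small, K being compact) makes (Ak : U) = (A : U) for k in K, so
   that lambda is right K-invariant without any use of the modular function. *)

(** * Topological groups *)

Lemma compact_seq_cover (T : ptopologicalType) (A : set T) (f : T -> set T) :
  compact A -> (forall x, A x -> nbhs x (f x)) ->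
  exists2 s : seq T, {in s, forall x, A x} &
    forall y, A y -> exists2 x, x \in s & f x y.
Proof.
rewrite compact_cover => cA fA.
have [||D DA AD] := cA T A (fun x => (f x)^°).
- by move=> x _; exact: open_interior.
- by move=> x Ax; exists x => //; exact: fA.
exists (enum_fset D) => [x xD|y /AD[x /= xD fxy]].
  exact: set_mem (DA x xD).
by exists x => //; exact: interior_subset fxy.
Qed.

Section TopologicalGroup.
Context (R : realType) (G : complexLieGroupType R).
Implicit Types (A B U V K : set G) (g k x y : G).

Lemma near_mulg x y A : nbhs (x * y)%g A ->
  \forall x' \near x & y' \near y, A (x' * y')%g.
Proof. by move=> /(@lie_mul_continuous R G (x, y)). Qed.

Lemma near_mull g x A : nbhs (g * x)%g A -> \forall y \near x, A (g * y)%g.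
Proof.
move=> /near_mulg [[P Q] [/= Pg Qx] PQ].
apply: filterS Qx => z Qz; apply: (PQ (g, z)); split => //=.
exact: nbhs_singleton.
Qed.

Lemma near_mulr g x A : nbhs (x * g)%g A -> \forall y \near x, A (y * g)%g.
Proof.
move=> /near_mulg [[P Q] [/= Px Qg] PQ].
apply: filterS Px => z Qz; apply: (PQ (z, g)); split => //=.
exact: nbhs_singleton.
Qed.

Lemma continuous_mull g : continuous (fun x => g * x)%g.
Proof. by move=> x A; exact: near_mull. Qed.

Lemma continuous_mulr g : continuous (fun x => x * g)%g.
Proof. by move=> x A; exact: near_mulr. Qed.

Lemma compact_mull g A : compact A -> compact [set g * a | a in A]%g.
Proof.
move=> cA; apply: continuous_compact => //.
by apply: continuous_subspaceT => x; exact: continuous_mull.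
Qed.

Lemma compact_mulr g A : compact A -> compact [set a * g | a in A]%g.
Proof.
move=> cA; apply: continuous_compact => //.
by apply: continuous_subspaceT => x; exact: continuous_mulr.
Qed.

Lemma mull_setK g A : [set g^-1 * a | a in [set g * a | a in A]]%g = A.
Proof.
rewrite predeqE => x; split=> [[_ [a Aa <-] <-]|Ax]; first by rewrite mulKg.
by exists (g * x)%g; [exists x|rewrite mulKg].
Qed.

Lemma mulr_setK g A : [set a * g^-1 | a in [set a * g | a in A]]%g = A.
Proof.
rewrite predeqE => x; split=> [[_ [a Aa <-] <-]|Ax]; first by rewrite mulgK.
by exists (x * g)%g; [exists x|rewrite mulgK].
Qed.

Lemma compact_mulset A B : compact A -> compact B ->
  compact [set a * b | a in A & b in B]%g.
Proof.
move=> cA cB.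
have -> : [set a * b | a in A & b in B]%g =
    (fun p : G * G => (p.1 * p.2)%g) @` (A `*` B).
  rewrite predeqE => x; split.
    by move=> [a Aa [b Bb <-]]; exists (a, b).
  by move=> [[a b] [/= Aa Bb] <-]; exists a => //; exists b.
apply: continuous_compact; last exact: compact_setX.
by apply: continuous_subspaceT; exact: lie_mul_continuous.
Qed.

Lemma nbhs_mull g A x : nbhs x A -> nbhs (g * x)%g [set g * a | a in A]%g.
Proof.
move=> Ax; have : nbhs (g^-1 * (g * x))%g A by rewrite mulKg.
move/near_mull; apply: filterS => y /= Ay.
by exists (g^-1 * y)%g => //; rewrite mulVKg.
Qed.

Lemma nbhs1_translate x U : nbhs 1%g U -> nbhs x [set y | U (x^-1 * y)%g].
Proof.
by rewrite -{1}(mulVg x) => /near_mull.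
Qed.

Lemma near_divg U : nbhs 1%g U ->
  exists2 W, nbhs 1%g W & forall u v, W u -> W v -> U (u^-1 * v)%g.
Proof.
move=> U1; have : nbhs (1^-1 * 1 : G)%g U by rewrite invg1 mul1g.
move=> /near_mulg [[P Q] [/= P1 Q1] PQ].
exists ([set x | P x^-1%g] `&` Q); last first.
  by move=> u v [Pu _] [_ Qv]; exact: (PQ (u^-1, v)%g).
apply: filterI => //; exact: (@lie_inv_continuous R G 1%g).
Qed.

(** [V] consists of the points all of whose conjugates by [K] lie in [U]. It is an intersection of
    possibly infinitely many neighbourhoods of 1, and compactness of [K], in the form of near
    coverings (the tube lemma), keeps it a neighbourhood. *)
Lemma nbhs1_conj_invariant K U : compact_subgroup K -> nbhs 1%g U ->
  exists V, [/\ nbhs 1%g V, V `<=` U &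
    forall k x, K k -> V x -> V (k^-1 * x * k)%g].
Proof.
move=> [K1 KM KV cK] U1.
exists [set x | forall k, K k -> U (k^-1 * x * k)%g]; split.
- have cov : near_covering K by apply/compact_near_coveringP.
  apply: (cov _ (nbhs (1 : G)%g) (fun x k => U (k^-1 * x * k)%g)) => k Kk.
  have : nbhs (k^-1 * 1 * k)%g U by rewrite mulg1 mulVg.
  move=> /near_mulg [[P Q] [/= + Qk] PQ].
  move=> /near_mulg [[P1 P2] [/= P1k P21] P12].
  exists ([set k' | P1 k'^-1%g] `&` Q, P2) => /=.
    split=> //; apply: filterI => //.
    exact: (@lie_inv_continuous R G k).
  move=> [k' x] /= [[P1k' Qk'] P2x].
  by apply: (PQ (_, _)); split => //=; apply: (P12 (_, _)).
- by move=> x /(_ 1%g K1); rewrite invg1 mul1g mulg1.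
- move=> k x Kk xV k' Kk'.
  have := xV (k * k')%g (KM _ _ Kk Kk').
  by rewrite invgM !mulgA.
Qed.

(** The compact set [A]^-1 [B] misses 1, so its complement contains all quotients u^-1 v with u, v
    in a small [W]. If a translate g[W] contained both a and b, then a^-1 b would be such a
    quotient. *)
Lemma disjoint_compact_separated A B : compact A -> compact B ->
  A `&` B = set0 ->
  exists2 W, nbhs 1%g W &
    forall g a b, A a -> B b -> W (g^-1 * a)%g -> ~ W (g^-1 * b)%g.
Proof.
move=> cA cB AB0.
pose C := [set a * b | a in [set x^-1 | x in A] & b in B]%g.
have cC : compact C.
  apply: compact_mulset => //; apply: continuous_compact => //.
  by apply: continuous_subspaceT; exact: lie_inv_continuous.
have oC : open (~` C).
  by rewrite openC; apply: compact_closed => //; exact: lie_hausdorff.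
have C1 : nbhs 1%g (~` C).
  apply: open_nbhs_nbhs; split => // -[_ [a Aa <-] [b Bb ab1]].
  have ab : b = a by rewrite -(mulVKg a b) ab1 mulg1.
  by have : (A `&` B) a; [split; rewrite -?ab // ab|rewrite AB0].
have [W W1 WC] := near_divg C1; exists W => // g a b Aa Bb Wa Wb.
apply: (WC _ _ Wa Wb); exists a^-1%g; first by exists a.
by exists b => //; rewrite invgM invgK mulgA mulgK.
Qed.

End TopologicalGroup.

(** * Covering numbers *)

Section CoveringNumber.
Context (R : realType) (G : complexLieGroupType R).
Implicit Types (A B U V K : set G) (g k x y : G).

Definition translates_cover U A (n : nat) :=
  exists2 s : seq G, (size s = n)%N &
    forall x, A x -> exists2 g, g \in s & U (g^-1 * x)%g.

(* Junk value 0 when no finite number of translates of U covers A. *)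
Definition covering_number U A : nat :=
  if pselect (exists n, `[< translates_cover U A n >]) is left e
  then ex_minn e else 0%N.

Lemma covering_number_le U A n :
  translates_cover U A n -> (covering_number U A <= n)%N.
Proof.
rewrite /covering_number => UAn; case: pselect => // e.
by case: ex_minnP => m _; apply; apply/asboolP.
Qed.

Lemma covering_numberP U A n : translates_cover U A n ->
  translates_cover U A (covering_number U A).
Proof.
rewrite /covering_number => UAn; case: pselect => [e|[]].
  by case: ex_minnP => m /asboolP.
by exists n; apply/asboolP.
Qed.

Lemma compact_translates_cover U A : compact A -> nbhs 1%g U ->
  exists n, translates_cover U A n.
Proof.
move=> cA U1.
have [x _|s _ sA] :=
    compact_seq_cover (f := fun x => [set y | U (x^-1 * y)%g]) cA.
  exact: nbhs1_translate.
by exists (size s), s.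
Qed.

Lemma covering_number_compact U A : compact A -> nbhs 1%g U ->
  translates_cover U A (covering_number U A).
Proof.
move=> cA U1; have [n] := compact_translates_cover cA U1.
exact: covering_numberP.
Qed.

Lemma covering_numberS U A B : compact B -> nbhs 1%g U ->
  A `<=` B -> (covering_number U A <= covering_number U B)%N.
Proof.
move=> cB U1 AB; have [s sn sB] := covering_number_compact cB U1.
by apply: covering_number_le; exists s => // x /AB; exact: sB.
Qed.

Lemma covering_numberU U A B : compact A -> compact B -> nbhs 1%g U ->
  (covering_number U (A `|` B) <= covering_number U A + covering_number U B)%N.
Proof.
move=> cA cB U1; have [s sn sA] := covering_number_compact cA U1.
have [t tn tB] := covering_number_compact cB U1.
apply: covering_number_le; exists (s ++ t); first by rewrite size_cat sn tn.
move=> x [/sA|/tB] [g gs Ug]; exists g => //; rewrite mem_cat gs ?orbT //.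
Qed.

(** No translate of [U] meets both sets, so an optimal cover of the union splits: the translates
    meeting [A] cover [A], and the remaining ones cover [B]. *)
Lemma covering_number_separated U A B : compact A -> compact B -> nbhs 1%g U ->
  (forall g a b, A a -> B b -> U (g^-1 * a)%g -> ~ U (g^-1 * b)%g) ->
  (covering_number U A + covering_number U B <= covering_number U (A `|` B))%N.
Proof.
move=> cA cB U1 sep.
have [s sn sAB] := covering_number_compact (compactU cA cB) U1.
pose P g := `[< exists2 a, A a & U (g^-1 * a)%g >].
rewrite -sn -(count_predC P s) -!size_filter; apply: leq_add.
  apply: covering_number_le; exists [seq g <- s | P g] => // x Ax.
  have [g gs Ug] := sAB x (or_introl Ax); exists g => //.
  by rewrite mem_filter gs andbT; apply/asboolP; exists x.
apply: covering_number_le; exists [seq g <- s | predC P g] => // x Bx.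
have [g gs Ug] := sAB x (or_intror Bx); exists g => //.
rewrite mem_filter gs andbT; apply/asboolPn => -[a Aa Uga].
exact: sep Aa Bx Uga Ug.
Qed.

Lemma covering_number_mull U A g : compact A -> nbhs 1%g U ->
  covering_number U [set g * a | a in A]%g = covering_number U A.
Proof.
move=> cA U1.
have le h B : compact B ->
    (covering_number U [set h * a | a in B]%g <= covering_number U B)%N.
  move=> cB; have [s sn sB] := covering_number_compact cB U1.
  apply: covering_number_le; exists [seq (h * x)%g | x <- s].
    by rewrite size_map.
  move=> _ [b Bb <-]; have [x xs Ux] := sB b Bb.
  by exists (h * x)%g; [exact: map_f|rewrite invgM -mulgA mulKg].
apply/eqP; rewrite eqn_leq le //=.
have /(le g^-1%g) : compact [set g * a | a in A]%g by exact: compact_mull.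
by rewrite mull_setK.
Qed.

(** Moving the centres x of a cover to xh works because (xh)^-1 (bh) = h^-1 (x^-1 b) h, a conjugate
    by an element of [K] of a point of [U]. *)
Lemma covering_number_mulr U A K k : compact_subgroup K -> K k ->
  compact A -> nbhs 1%g U ->
  (forall k x, K k -> U x -> U (k^-1 * x * k)%g) ->
  covering_number U [set a * k | a in A]%g = covering_number U A.
Proof.
move=> [K1 KM KV cK] Kk cA U1 UK.
have le h B : K h -> compact B ->
    (covering_number U [set a * h | a in B]%g <= covering_number U B)%N.
  move=> Kh cB; have [s sn sB] := covering_number_compact cB U1.
  apply: covering_number_le; exists [seq (x * h)%g | x <- s].
    by rewrite size_map.
  move=> _ [b Bb <-]; have [x xs Ux] := sB b Bb.
  exists (x * h)%g; first exact: map_f.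
  by rewrite invgM mulgA -(mulgA h^-1%g); exact: UK.
apply/eqP; rewrite eqn_leq le //=.
have /(le k^-1%g _ (KV _ Kk)) : compact [set a * k | a in A]%g.
  exact: compact_mulr.
by rewrite mulr_setK.
Qed.

(** Cover [A] by translates g[V], then each of these by translates gh[U]. This bounds the ratio (A :
    U) / (V : U) by (A : V), uniformly in [U]. *)
Lemma covering_number_trans U A V : compact A -> compact V ->
  nbhs 1%g V -> nbhs 1%g U ->
  (covering_number U A <= covering_number V A * covering_number U V)%N.
Proof.
move=> cA cV V1 U1; have [s sn sA] := covering_number_compact cA V1.
have [t tn tV] := covering_number_compact cV U1.
apply: covering_number_le; exists [seq (x * y)%g | x <- s, y <- t].
  by rewrite size_allpairs sn tn.
move=> x /sA[g gs /tV[h ht Uh]]; exists (g * h)%g.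
  by apply/allpairsP; exists (g, h).
by rewrite invgM -mulgA.
Qed.

Lemma covering_number_gt0 U A : compact A -> nbhs 1%g U -> A !=set0 ->
  (0 < covering_number U A)%N.
Proof.
move=> cA U1 [x Ax]; have [s sn sA] := covering_number_compact cA U1.
by have [g gs _] := sA x Ax; rewrite -sn; case: s gs {sn sA}.
Qed.

End CoveringNumber.

(** * The Haar content *)

Lemma ultra_fmap (T U : Type) (f : T -> U) (F : set_system T) :
  UltraFilter F -> UltraFilter (fmap f F).
Proof.
move=> FU; have FP := ultra_proper; split=> [|H HP FH].
  exact: fmap_proper_filter.
apply/seteqP; split=> // A HA; have [//|FA] := in_ultra_setVsetC (f @^-1` A) FU.
have HCA : H (~` A) by apply: FH.
by exfalso; apply: (@filter_not_empty _ H); rewrite -(setICr A); exact: filterI.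
Qed.

Lemma ler_cvg (R : realType) (T : Type) (F : set_system T) (f g : T -> R)
    (a b : R) :
  ProperFilter F -> f x @[x --> F] --> a -> g x @[x --> F] --> b ->
  (\forall x \near F, f x <= g x) -> a <= b.
Proof.
move=> FF fa gb fg; rewrite -subr_ge0.
have gf : (g \- f) x @[x --> F] --> b - a by exact: cvgB.
rewrite -(cvg_lim _ gf)//; apply: limr_ge; first by apply/cvg_ex; exists (b - a).
by apply: filterS fg => x; rewrite subr_ge0.
Qed.

Section HaarContent.
Context (R : realType) (G : complexLieGroupType R).
Implicit Types (A B U V K : set G) (g k x y : G).

(** Additivity on disjoint compact sets is recorded only as superadditivity; the third clause
    supplies the other inequality. *)
Definition compact_content (phi : set G -> R) :=
  [/\ forall A, compact A -> 0 <= phi A,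
      forall A B, compact A -> compact B -> A `<=` B -> phi A <= phi B,
      forall A B, compact A -> compact B -> phi (A `|` B) <= phi A + phi B
    & forall A B, compact A -> compact B -> A `&` B = set0 ->
        phi A + phi B <= phi (A `|` B)].

Lemma haar_content K V : compact_subgroup K -> compact V -> nbhs 1%g V ->
  exists phi : set G -> R,
  [/\ compact_content phi, phi V = 1,
      forall g A, compact A -> phi [set g * a | a in A]%g = phi A
    & forall k A, K k -> compact A -> phi [set a * k | a in A]%g = phi A].
Proof.
move=> gK cV V1.
pose inv U := forall k x, K k -> U x -> U (k^-1 * x * k)%g.
pose small W := [set U : set G | [/\ nbhs 1%g U, U `<=` W & inv U]].
(* The families [small W] form a filter base on the sets of neighbourhoods; limits along an
   ultrafilter [H] refining it replace letting [U] shrink to 1. *)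
have [H [HU smallH]] : exists H, UltraFilter H /\
    filter_from (nbhs (1 : G)%g) small `<=` H.
  apply: ultraFilterLemma; apply: filter_from_proper.
    apply: filter_from_filter; first by exists setT; exact: filterT.
    move=> W W' W1 W'1; exists (W `&` W'); first exact: filterI.
    by move=> U [U1]; rewrite subsetI => -[UW UW'] invU; split; split.
  by move=> W /(nbhs1_conj_invariant gK) [U [U1 UW invU]]; exists U; split.
have HP : ProperFilter H by exact: ultra_proper.
have nearH W : nbhs 1%g W -> \forall U \near H, [/\ nbhs 1%g U, U `<=` W & inv U].
  by move=> W1; apply: smallH; exists W.
have nearH1 : \forall U \near H, nbhs 1%g U /\ inv U.
  by apply: filterS (nearH setT filterT) => U [].
pose ratio A U : R := (covering_number U A)%:R / (covering_number U V)%:R.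
have VU U : nbhs 1%g U -> 0 < (covering_number U V)%:R :> R.
  move=> U1; rewrite ltr0n; apply: covering_number_gt0 => //.
  by exists 1%g; exact: nbhs_singleton.
have ratio_cvg A : compact A -> exists l : R, ratio A U @[U --> H] --> l.
  (* The ratios eventually stay in the segment [0, (A : V)], so compactness makes them converge
     along the ultrafilter. *)
  move=> cA; have := @segment_compact R 0 (covering_number V A)%:R.
  rewrite compact_ultra => /(_ _ (ultra_fmap (ratio A) HU)) [|l [_ rl]].
    apply: filterS nearH1 => U [U1 _] /=.
    rewrite in_itv/= divr_ge0 ?ler0n //= ler_pdivrMr ?VU // -natrM ler_nat.
    exact: covering_number_trans.
  by exists l.
pose phi A := lim (ratio A U @[U --> H]).
have phiP A : compact A -> ratio A U @[U --> H] --> phi A.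
  by move=> /ratio_cvg [l rl]; apply/cvg_ex; exists l.
have phi_le A B : compact A -> compact B ->
    (\forall U \near H, (covering_number U A <= covering_number U B)%N) ->
    phi A <= phi B.
  move=> cA cB AB; apply: (ler_cvg HP (phiP _ cA) (phiP _ cB)).
  apply: filterS2 nearH1 AB => U [U1 _] AB.
  by rewrite ler_pM2r ?invr_gt0 ?VU // ler_nat.
exists phi; split.
- split.
  + move=> A cA; apply: (ler_cvg HP _ (phiP _ cA)); first exact: cvg_cst.
    by apply: nearW => U; rewrite divr_ge0.
  + move=> A B cA cB AB; apply: phi_le => //.
    by apply: filterS nearH1 => U [U1 _]; exact: covering_numberS.
  + move=> A B cA cB.
    apply: (ler_cvg HP (phiP _ (compactU cA cB)) (cvgD (phiP _ cA) (phiP _ cB))).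
    apply: filterS nearH1 => U [U1 _].
    by rewrite /= -mulrDl -natrD ler_pM2r ?invr_gt0 ?VU // ler_nat covering_numberU.
  + move=> A B cA cB AB0.
    apply: (ler_cvg HP (cvgD (phiP _ cA) (phiP _ cB)) (phiP _ (compactU cA cB))).
    (* Eventually [U] lies in [W], hence is fine enough to separate [A] from [B]; the covering
       numbers are then superadditive before passing to the limit. *)
    have [W W1 sepW] := disjoint_compact_separated cA cB AB0.
    apply: filterS (nearH _ W1) => U [U1 UW _].
    rewrite /= -mulrDl -natrD ler_pM2r ?invr_gt0 ?VU // ler_nat.
    apply: covering_number_separated => // g a b Aa Bb Ua Ub.
    exact: (sepW g a b Aa Bb (UW _ Ua) (UW _ Ub)).
- have V_ratio : \forall U \near H, ratio V U = 1.
    by apply: filterS nearH1 => U [U1 _]; rewrite /ratio divff // gt_eqF ?VU.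
  apply/eqP; rewrite eq_le; apply/andP; split.
    apply: (ler_cvg HP (phiP _ cV)); first exact: (cvg_cst (1 : R)).
    by apply: filterS V_ratio => U ->.
  apply: (ler_cvg HP _ (phiP _ cV)); first exact: (cvg_cst (1 : R)).
  by apply: filterS V_ratio => U ->.
- move=> g A cA; have cgA := compact_mull (g := g) cA.
  by apply/eqP; rewrite eq_le !phi_le //;
    apply: filterS nearH1 => U [U1 _]; rewrite covering_number_mull.
- move=> k A Kk cA; have cgA := compact_mulr (g := k) cA.
  by apply/eqP; rewrite eq_le !phi_le //;
    apply: filterS nearH1 => U [U1 iU]; rewrite (covering_number_mulr gK).
Qed.

End HaarContent.

(** * The Haar measure *)

Section HaarMeasure.
Context (R : realType) (G : complexLieGroupType R).
Implicit Types (A B C O U V K : set G) (x y : G).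
Variable phi : set G -> R.
Hypothesis phiP : compact_content phi.

(* The value +oo off the open sets turns [mu_ext] into an infimum over countable
   open covers. *)
Definition open_content (O : set (borel G)) : \bar R :=
  if pselect (open (O : set G))
  then ereal_sup [set (phi C)%:E | C in [set C | compact C /\ C `<=` O]]
  else +oo%E.

Local Notation mu := (mu_ext open_content : set G -> \bar R).

Let phi_ge0 A : compact A -> 0 <= phi A.
Proof. by case: phiP => + _ _ _; apply. Qed.

Let phiS A B : compact A -> compact B -> A `<=` B -> phi A <= phi B.
Proof. by case: phiP => _ + _ _; apply. Qed.

Let phiU A B : compact A -> compact B -> phi (A `|` B) <= phi A + phi B.
Proof. by case: phiP => _ _ + _; apply. Qed.

Let phi_disjointU A B : compact A -> compact B -> A `&` B = set0 ->
  phi A + phi B <= phi (A `|` B).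
Proof. by case: phiP => _ _ _; apply. Qed.

Let phi0 : phi set0 = 0.
Proof.
apply/eqP; rewrite eq_le phi_ge0 ?andbT; last exact: compact0.
have := phi_disjointU (@compact0 G) (@compact0 G) (setI0 _).
by rewrite setU0 gerDl.
Qed.

Lemma content_le_open_content C O : compact C -> C `<=` O ->
  ((phi C)%:E <= open_content O)%E.
Proof.
move=> cC CO; rewrite /open_content; case: pselect => [oO|nO]; last by rewrite leey.
by apply: ereal_sup_ubound; exists C.
Qed.

Lemma open_content_le O (b : \bar R) : open O ->
  (forall C, compact C -> C `<=` O -> ((phi C)%:E <= b)%E) ->
  (open_content O <= b)%E.
Proof.
move=> oO Ob; rewrite /open_content; case: pselect => // oO'.
by apply: ge_ereal_sup => _ [C [cC CO] <-]; exact: Ob.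
Qed.

Lemma open_content_ge0 O : (0 <= open_content O)%E.
Proof.
rewrite -[leLHS]/((0 : R)%:E) -phi0; apply: content_le_open_content; first exact: compact0.
exact: sub0set.
Qed.

Lemma open_content0 : open_content set0 = 0%E.
Proof.
apply/eqP; rewrite eq_le open_content_ge0 andbT; apply: open_content_le.
  exact: open0.
by move=> C _; rewrite subset0 => ->; rewrite phi0.
Qed.

Let mu_ge0 A : (0 <= mu A)%E.
Proof. exact: (@mu_ext_ge0 _ (borel G) R _ open_content_ge0). Qed.

Let mu0 : mu set0 = 0%E.
Proof. exact: (@mu_ext0 _ (borel G) R _ open_content0 open_content_ge0). Qed.

Let mu_sigma_subadditive : sigma_subadditive mu.
Proof.
exact: (@mu_ext_sigma_subadditive _ (borel G) R _ open_content_ge0).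
Qed.

Let le_mu A B : A `<=` B -> (mu A <= mu B)%E.
Proof. exact: (@le_mu_ext _ (borel G)). Qed.

Lemma haar_outer_measure : exists m : {outer_measure set G -> \bar R},
  m = mu :> (set G -> \bar R).
Proof.
pose om := isOuterMeasure.Build R G mu mu0 mu_ge0 le_mu mu_sigma_subadditive.
pose m : {outer_measure set G -> \bar R} := HB.pack mu om.
by exists m.
Qed.

Lemma mu_ext_le_open A O : open O -> A `<=` O -> (mu A <= open_content O)%E.
Proof.
move=> oO AO; apply: ereal_inf_lbound.
exists (fun k => if k is 0%N then O else set0).
  split; last by move=> x /AO Ox; exists 0%N.
  by case=> [|k]; [exact: sub_sigma_algebra|exact: measurable0].
rewrite nneseries_recl //; last by move=> k _; exact: open_content_ge0.
rewrite eseries0 ?adde0 // => -[//|k] _ _; exact: open_content0.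
Qed.

(** A cover with a member that is not open has total content +oo, so a lower bound need only be
    tested on open covers. *)
Lemma le_mu_ext_open A (b : \bar R) :
  (forall F : nat -> set G, (forall k, open (F k)) -> A `<=` \bigcup_k F k ->
    (b <= \sum_(k <oo) open_content (F k))%E) ->
  (b <= mu A)%E.
Proof.
move=> bA; apply: le_ereal_inf_tmp => _ [F [mF AF] <-].
have [oF|/existsNP[k nFk]] := pselect (forall k, open (F k : set G)).
  exact: bA.
rewrite (eseries_pinfty _ _ (_ : open_content (F k) = +oo%E)) ?leey //.
- by move=> n _; rewrite gt_eqF // (lt_le_trans _ (open_content_ge0 _)).
- by rewrite /open_content; case: pselect.
Qed.

Lemma content_bigsetU (D : nat -> set G) n : (forall k, compact (D k)) ->
  phi (\big[setU/set0]_(k < n) D k) <= \sum_(k < n) phi (D k).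
Proof.
move=> cD; elim: n => [|n IH]; first by rewrite !big_ord0 phi0.
rewrite !big_ord_recr /=; apply: (le_trans (phiU _ _)) => //.
  exact: bigsetU_compact.
by rewrite lerD2r.
Qed.

(** Every point of [A] has a compact neighbourhood inside a single member of the open cover.
    Finitely many of these suffice, and finite subadditivity of [phi] on compact sets gives the
    bound. Local compactness comes from translating [V]. *)
Lemma content_le_mu_ext V A : compact V -> nbhs 1%g V ->
  compact A -> ((phi A)%:E <= mu A)%E.
Proof.
move=> cV V1 cA; apply: le_mu_ext_open => F oF AF.
have /choice[f fP] : forall x, exists p : nat * set G, A x ->
    [/\ compact p.2, nbhs x p.2 & p.2 `<=` F p.1].
  move=> x; have [/AF[i _ Fix]|nAx] := pselect (A x); last by exists (0%N, set0).
  pose xV := [set x * v | v in V]%g.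
  have cxV : compact xV by exact: compact_mull.
  have xVx : nbhs x xV by rewrite -{1}(mulg1 x); exact: nbhs_mull.
  have Fi : nbhs x (F i) by exact: open_nbhs_nbhs.
  have [B Bx BF] := compact_regular (@lie_hausdorff R G) cxV xVx Fi.
  exists (i, xV `&` closure B) => _ /=; split.
  - by apply: compact_closedI => //; exact: closed_closure.
  - by apply: filterI => //; apply: filterS Bx; exact: subset_closure.
  - by apply: subset_trans BF; exact: subIsetr.
have [x Ax|s sA As] := compact_seq_cover (f := fun x => (f x).2) cA.
  by have [] := fP x Ax.
(* The chosen neighbourhoods are grouped by the index of the member of the cover containing them, so
   that each [F k] is charged only once. *)
pose D k := \big[setU/set0]_(x <- s | (f x).1 == k) (f x).2.
have cD k : compact (D k).
  rewrite /D big_seq_cond; apply: bigsetU_compact => x /andP[/sA xA _].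
  by have [] := fP x xA.
have DF k : D k `<=` F k.
  move=> y; rewrite /D -bigcup_seq_cond => -[x /= /andP[xs /eqP <-] fxy].
  by have [_ _] := fP x (sA x xs); apply.
pose n := (\max_(x <- s) (f x).1).+1.
have AD : A `<=` \big[setU/set0]_(k < n) D k.
  move=> y /As[x xs fxy]; rewrite -bigcup_mkord; exists (f x).1 => /=.
    by rewrite ltnS; exact: leq_bigmax_seq.
  by rewrite /D -bigcup_seq_cond; exists x => //=; rewrite xs eqxx.
have cDn : compact (\big[setU/set0]_(k < n) D k) by exact: bigsetU_compact.
apply: (@le_trans _ _ (\sum_(k < n) (phi (D k))%:E)%E).
  by rewrite sumEFin lee_fin (le_trans (phiS cA cDn AD)) // content_bigsetU.
apply: (@le_trans _ _ (\sum_(0 <= k < n) open_content (F k))%E).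
  rewrite big_mkord; apply: lee_sum => k _; exact: content_le_open_content.
by apply: nneseries_lim_ge => k _ _; exact: open_content_ge0.
Qed.

Lemma mu_ext_compact V A : compact V -> nbhs 1%g V ->
  compact A -> (mu A < +oo)%E.
Proof.
move=> cV V1 cA; pose AV := [set a * v | a in A & v in V]%g.
have cAV : compact AV by exact: compact_mulset.
apply: (@le_lt_trans _ _ (phi AV)%:E); last exact: ltry.
apply: (@le_trans _ _ (open_content AV^°)).
  apply: mu_ext_le_open; first exact: open_interior.
  move=> x Ax; have := nbhs_mull x V1; rewrite mulg1.
  by apply: filterS => _ [v Vv <-]; exists x => //; exists v.
apply: open_content_le => [|C cC CAV]; first exact: open_interior.
rewrite lee_fin; apply: phiS => //.
by apply: subset_trans CAV _; exact: interior_subset.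
Qed.

(** For a compact [C] inside [P] and [O], the set [P] minus [C] is open and contains [P] minus [O].
    A compact [D] inside it is disjoint from [C], so phi C + phi D is at most the content of [P]. It
    remains to take suprema over [D] and then over [C]. *)
Lemma open_content_split O P : open O -> open P ->
  (mu (P `&` O) + mu (P `&` ~` O) <= open_content P)%E.
Proof.
move=> oO oP.
have split C : compact C -> C `<=` P `&` O ->
    ((phi C)%:E + mu (P `&` ~` O) <= open_content P)%E.
  move=> cC CPO.
  have oPC : open (P `&` ~` C).
    apply: openI => //; rewrite openC; apply: compact_closed => //.
    exact: lie_hausdorff.
  apply: (@le_trans _ _ ((phi C)%:E + open_content (P `&` ~` C))%E).
    apply: leeD2l; apply: mu_ext_le_open => //.
    by move=> x [Px nOx]; split => // /CPO[].
  rewrite -leeBrDl //; apply: open_content_le => // D cD DPC.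
  rewrite leeBrDl // -EFinD.
  apply: (@le_trans _ _ (phi (C `|` D))%:E).
    rewrite lee_fin; apply: phi_disjointU => //.
    by rewrite predeqE => x; split => // -[Cx /DPC[]].
  apply: content_le_open_content; first exact: compactU.
  by move=> x [/CPO[]|/DPC[]].
have mu_le : (mu (P `&` ~` O) <= open_content P)%E.
  rewrite -[leLHS]add0e -[X in (X + _)%E]/((0 : R)%:E) -phi0.
  by apply: split; [exact: compact0|exact: sub0set].
(* Subtraction is legitimate only for a finite value. The value +oo forces the right-hand side to be
   +oo by [mu_le], and -oo contradicts nonnegativity. *)
have [[m Em]|Em|Em] : [\/ exists m : R, mu (P `&` ~` O) = m%:E,
    mu (P `&` ~` O) = +oo%E | mu (P `&` ~` O) = -oo%E].
- by case: (mu (P `&` ~` O)) => [m| |]; [constructor 1; exists m|constructor 2|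
    constructor 3].
- rewrite Em -leeBrDr //.
  apply: (le_trans (mu_ext_le_open (openI oP oO) (@subset_refl _ _))).
  apply: open_content_le; first exact: openI.
  by move=> C cC CPO; rewrite leeBrDr // -Em split.
- by move: mu_le; rewrite Em leye_eq => /eqP ->; rewrite leey.
- by have := mu_ge0 (P `&` ~` O); rewrite Em.
Qed.

(** For an open cover of the test set [X], each member is split along [O] by [open_content_split];
    summing bounds both parts of [X] by countable subadditivity. *)
Lemma open_caratheodory O : open O -> mu.-caratheodory O.
Proof.
move=> oO; have [m mE] := haar_outer_measure; rewrite -mE.
apply: le_caratheodory_measurable => X; rewrite mE.
apply: le_mu_ext_open => F oF XF.
apply: (@le_trans _ _ (\sum_(k <oo) (mu (F k `&` O) + mu (F k `&` ~` O)))%E).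
  rewrite nneseriesD; last 2 first.
  - by move=> *; exact: mu_ge0.
  - by move=> *; exact: mu_ge0.
  apply: leeD.
    apply: le_trans (mu_sigma_subadditive _).
    by apply: le_mu => x [/XF[k _ Fkx] Ox]; exists k.
  apply: le_trans (mu_sigma_subadditive _).
  by apply: le_mu => x [/XF[k _ Fkx] Ox]; exists k.
apply: lee_nneseries => [k *|k _]; last exact: open_content_split.
by apply: adde_ge0; exact: mu_ge0.
Qed.

(** A homeomorphism [f] carries open covers to open covers without increasing contents: a compact
    subset of the image of [F k] is pulled back by [h] to a compact subset of [F k] with the same
    [phi]. *)
Lemma mu_ext_image_le (f h : G -> G) A : cancel f h -> cancel h f ->
  continuous f -> continuous h ->
  (forall C, compact C -> phi (h @` C) = phi C) -> (mu (f @` A) <= mu A)%E.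
Proof.
move=> fK hK cf ch phih; apply: le_mu_ext_open => F oF AF.
have fE O : f @` O = h @^-1` O.
  rewrite predeqE => x; split=> [[y Oy <-]|Ohx]; first by rewrite /= fK.
  by exists (h x).
have of_ k : open (f @` F k) by rewrite fE; apply: open_comp => // x _; exact: ch.
apply: (@le_trans _ _ (\sum_(k <oo) open_content (f @` F k))%E).
  apply: ereal_inf_lbound; exists (fun k => f @` F k) => //; split.
    by move=> k; exact: sub_sigma_algebra.
  by move=> _ [x /AF[k _ Fkx] <-]; exists k => //; exists x.
apply: lee_nneseries => [k *|k _]; first exact: open_content_ge0.
apply: open_content_le => // C cC CF; rewrite -phih //.
apply: content_le_open_content.
  by apply: continuous_compact => //; exact: continuous_subspaceT.
by move=> _ [x /CF[y Fy <-] <-]; rewrite fK.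
Qed.

Lemma mu_ext_image (f h : G -> G) A : cancel f h -> cancel h f ->
  continuous f -> continuous h ->
  (forall C, compact C -> phi (f @` C) = phi C) -> mu (f @` A) = mu A.
Proof.
move=> fK hK cf ch phif; apply/eqP; rewrite eq_le.
have hfK B : h @` (f @` B) = B.
  rewrite predeqE => x; split=> [[_ [y By <-] <-]|Bx]; first by rewrite fK.
  by exists (f x) => //; exists x.
have fhK B : f @` (h @` B) = B.
  rewrite predeqE => x; split=> [[_ [y By <-] <-]|Bx]; first by rewrite hK.
  by exists (h x) => //; exists x.
rewrite (mu_ext_image_le _ fK hK cf ch); last first.
  move=> C cC; rewrite -{2}(fhK C) phif //.
  by apply: continuous_compact => //; exact: continuous_subspaceT.
by rewrite -{1}(hfK A) (mu_ext_image_le _ hK fK ch cf).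
Qed.

(** The Caratheodory measurable sets form a sigma-algebra containing the open sets, hence all Borel
    sets, and the outer measure is countably additive on it. *)
Lemma haar_borel_measure : exists m : {measure set (borel G) -> \bar R},
  m = mu :> (set G -> \bar R).
Proof.
have [om omE] := haar_outer_measure.
have mcara (A : set (borel G)) : measurable A -> om.-caratheodory A.
  apply: smallest_sub; last by move=> O oO; rewrite omE; exact: open_caratheodory.
  split.
  - exact: caratheodory_measurable_set0.
  - by move=> B mB; rewrite setTD; exact: caratheodory_measurable_setC.
  - by move=> B mB; exact: caratheodory_measurable_bigcup.
have sadd : semi_sigma_additive (mu : set (borel G) -> \bar R).
  move=> F mF tF mUF; rewrite -omE.
  apply: (@caratheodory_measure_sigma_additive R G om) => //.
    by move=> k; exact: mcara.
  exact: mcara.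
pose im := isMeasure.Build _ _ _ (mu : set (borel G) -> \bar R)
  mu0 mu_ge0 sadd.
pose m : {measure set (borel G) -> \bar R} :=
  HB.pack (mu : set (borel G) -> \bar R) im.
by exists m.
Qed.

End HaarMeasure.

Lemma haar_measure (R : realType) (G : complexLieGroupType R) (K V : set G) :
  compact_subgroup K -> compact V -> nbhs 1%g V ->
  exists lambda : {measure set (borel G) -> \bar R}, left_haar lambda /\
    forall (k : G) (A : set G), K k ->
      lambda [set a * k | a in A]%g = lambda A.
Proof.
move=> gK cV V1; have [phi [phiP phiV phil phir]] := haar_content gK cV V1.
have [m mE] := haar_borel_measure phiP.
exists m; split; first split.
- rewrite mE gt_eqF // (@lt_le_trans _ _ (phi V)%:E) ?phiV ?lte_fin //.
  rewrite -phiV; apply: (le_trans (content_le_mu_ext phiP cV V1 cV)).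
  exact: le_mu_ext.
- by move=> A cA; rewrite mE; exact: (mu_ext_compact phiP cV V1).
- move=> g A mA; rewrite mE.
  apply: (@mu_ext_image R G phi phiP (fun x => g * x)%g (fun x => g^-1 * x)%g).
  + exact: mulKg.
  + exact: mulVKg.
  + exact: continuous_mull.
  + exact: continuous_mull.
  + by move=> C; exact: phil.
- move=> k A Kk; rewrite mE.
  apply: (@mu_ext_image R G phi phiP (fun x => x * k)%g (fun x => x * k^-1)%g).
  + exact: mulgK.
  + exact: mulgVK.
  + exact: continuous_mulr.
  + exact: continuous_mulr.
  + by move=> C; exact: phir.
Qed.

(** * The topology of the complex numbers and of complex Lie groups *)

Section ComplexTopology.
Context (R : realType).
Import ComplexField.Normc.

(** The norm of [R[i]^o] takes values in [R[i]], so the radii of balls are complex numbers. Positive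
    ones are real, which allows working with radii in [R]. *)
Lemma nbhs_normcP (z : R[i]^o) (A : set R[i]^o) :
  nbhs z A <-> exists2 e : R, 0 < e & forall w, normc (z - w) < e -> A w.
Proof.
split.
  move=> /nbhs_normP [[e e'] /= e0 zA]; move: e0; rewrite ltcE /= => /andP[/eqP ? e0].
  by exists e => // w zw; apply: zA => /=; rewrite ltcE /= zw andbT; apply/eqP.
move=> [e e0 zA]; apply: (@nbhs_normP _ R[i]^o z A).2; exists e%:C%C; first by rewrite /= ltcR.
by move=> w /=; rewrite ltcE /= => /andP[_ ?]; exact: zA.
Qed.

Lemma continuous_normc : continuous (@normc R : R[i]^o -> R).
Proof.
move=> z A nA; have [e /= e0 zA] := (@nbhs_normP R R^o (normc z) A).1 nA.
apply/nbhs_normcP; exists e => // w zw.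
apply: zA => /=; apply: le_lt_trans zw; rewrite ler_norml.
have normcB : normc (w - z) = normc (z - w) by rewrite -opprB; exact: normcN.
have h1 : normc z <= normc (z - w) + normc w.
  by rewrite -[in leLHS](subrK w z); exact: le_normcD.
have h2 : normc w <= normc (z - w) + normc z.
  by rewrite -normcB -[in leLHS](subrK z w); exact: le_normcD.
apply/andP; split; lra.
Qed.

Lemma Re_le_normc (z : R[i]) : complex.Re z <= normc z.
Proof.
case: z => a b /=; apply: (le_trans (ler_norm a)); rewrite -sqrtr_sqr.
by rewrite ler_wsqrtr // lerDl sqr_ge0.
Qed.

Lemma normc_ge0 (z : R[i]) : 0 <= normc z.
Proof. by case: z => a b /=; rewrite sqrtr_ge0. Qed.

Lemma normc_le_max (a b e : R) : 0 <= e -> `|a| <= e -> `|b| <= e ->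
  normc (Complex a b) <= 2 * e.
Proof.
move=> e0 ae be /=; rewrite -(ger0_norm (_ : 0 <= 2 * e)) ?mulr_ge0 //.
rewrite -sqrtr_sqr ler_wsqrtr // -(real_normK (num_real a)) -(real_normK (num_real b)).
have := normr_ge0 a; have := normr_ge0 b; nra.
Qed.

Lemma continuous_Complex :
  continuous (fun p : R * R => Complex p.1 p.2 : R[i]^o).
Proof.
move=> [a b] A /nbhs_normcP [e e0 zA].
have e4 : 0 < e / 4 by rewrite divr_gt0.
exists (ball a (e / 4), ball b (e / 4)); first by split; exact: nbhsx_ballx.
move=> [a' b'] [/= aa bb]; apply: zA.
apply: (@le_lt_trans _ _ (2 * (e / 4))); last by lra.
by apply: normc_le_max; exact: ltW.
Qed.

Lemma complex_compact_nbhs (z : R[i]^o) A : nbhs z A ->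
  exists B, [/\ compact B, nbhs z B & B `<=` A].
Proof.
case: z => x y /nbhs_normcP [e e0 zA].
have e4 : 0 < e / 4 by rewrite divr_gt0.
(* The closed square of half-side e/4 is the continuous image of a product of segments; its points
   are within 2(e/4) < e of the centre. *)
exists ((fun p : R * R => Complex p.1 p.2 : R[i]^o) @`
  (`[x - e / 4, x + e / 4] `*` `[y - e / 4, y + e / 4])); split.
- have cS : compact (`[x - e / 4, x + e / 4] `*` `[y - e / 4, y + e / 4]).
    by apply: compact_setX; exact: segment_compact.
  exact: (continuous_compact (continuous_subspaceT continuous_Complex) cS).
- apply/nbhs_normcP; exists (e / 4) => // -[a b] /= ab1; exists (a, b) => //.
  have le1 (u v : R) : Num.sqrt (u ^+ 2 + v ^+ 2) < e / 4 -> `|u| < e / 4.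
    by apply: le_lt_trans; rewrite -sqrtr_sqr ler_wsqrtr // lerDl sqr_ge0.
  have := le1 _ _ ab1; rewrite addrC in ab1; have := le1 _ _ ab1.
  rewrite !ltr_norml => /andP[b1 b2] /andP[a1 a2].
  by split; rewrite /= in_itv /=; apply/andP; split; lra.
- move=> w [[a b] [/=]]; rewrite !in_itv /= => /andP[a1 a2] /andP[b1 b2] <-.
  apply: zA; apply: (@le_lt_trans _ _ (2 * (e / 4))); last by lra.
  by apply: normc_le_max; rewrite ?ler_norml; try (apply/andP; split); lra.
Qed.

Lemma rV_compact_nbhs n (v : 'rV[R[i]^o]_n) A : nbhs v A ->
  exists B, [/\ compact B, nbhs v B & B `<=` A].
Proof.
move=> [P vP PA].
have /choice[B BP] : forall i, exists B : set R[i]^o,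
    [/\ compact B, nbhs (v ord0 i) B & B `<=` P ord0 i].
  by move=> i; exact: complex_compact_nbhs.
exists [set u : 'rV[R[i]^o]_n | forall i, B i (u ord0 i)]; split.
- by apply: rV_compact => i; have [] := BP i.
- exists (fun _ => B); last by move=> u uB i; exact: uB.
  by move=> i j; rewrite ord1; have [] := BP j.
- move=> u uB; apply: PA => i j; rewrite ord1.
  by have [_ _] := BP j; apply; exact: uB.
Qed.

End ComplexTopology.

Section LieGroupTopology.
Context (R : realType) (G : complexLieGroupType R).

Lemma compact_nbhs (x : G) : exists2 B, compact B & nbhs x B.
Proof.
have [c ac cx] := @atlas_cover R G x.
have imgN : nbhs (chart_fun c x) (chart_fun c @` chart_dom c).
  by apply: open_nbhs_nbhs; split; [exact: chart_img_open|exists x].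
have [B [cB xB Bimg]] := rV_compact_nbhs imgN.
exists (chart_inv c @` B).
  apply: continuous_compact => //; apply: continuous_in_subspaceT => y.
  by move=> /set_mem/Bimg yimg; exact: (@chart_inv_continuous _ _ _ c y (mem_set yimg)).
have xdom : nbhs x (chart_dom c).
  by apply: open_nbhs_nbhs; split => //; exact: chart_dom_open.
have := @chart_fun_continuous _ _ _ c x (mem_set cx) B xB.
apply: filterS2 xdom => y cy By; exists (chart_fun c y) => //.
exact: (@chart_funK _ _ _ c y (mem_set cy)).
Qed.

End LieGroupTopology.

(** * Holomorphic functions *)

(** A first-order expansion at [x] sees only values near [x], so the differential of [f] serves for
    [g] too. It is used for identities in charts, which hold only locally. *)
Lemma near_eq_differentiable (K : numFieldType) (V W : normedModType K)
    (f g : V -> W) (x : V) :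
  (\forall y \near x, f y = g y) -> differentiable f x -> differentiable g x.
Proof.
move=> fg df; have [dc dE] := (diff_locallyP x f).1 df.
have gE : g \o shift x = cst (g x) + 'd f x +o_ (0 : V) id.
  apply/eqaddoP => _ /posnumP[e]; move/eqaddoP : dE => /(_ e%:num (gt0 e)).
  have fg0 : \forall h \near (0 : V), f (h + x) = g (h + x).
    by move: fg; rewrite (near_shift 0) subr0.
  apply: filterS2 fg0 => h fgh.
  by rewrite /= !fctE /= fgh (nbhs_singleton fg).
by apply/diff_locallyP; rewrite (diff_unique dc gE).
Qed.

Section Holomorphic.
Context (R : realType) (G : complexLieGroupType R).

Lemma near_chart_funK (c : chart R G (@cdim R G)) x : chart_dom c x ->
  \forall y \near x, chart_inv c (chart_fun c y) = y.
Proof.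
move=> cx; have : nbhs x (chart_dom c).
  by apply: open_nbhs_nbhs; split => //; exact: chart_dom_open.
by apply: filterS => y cy; exact: (@chart_funK _ _ _ c y (mem_set cy)).
Qed.

Lemma near_chart_inv (c : chart R G (@cdim R G)) x (A : set G) :
  chart_dom c x -> nbhs x A ->
  \forall p \near chart_fun c x, A (chart_inv c p).
Proof.
move=> cx xA; have imgx : (chart_fun c @` chart_dom c) (chart_fun c x).
  by exists x.
apply: (@chart_inv_continuous _ _ _ c _ (mem_set imgx)).
by rewrite (@chart_funK _ _ _ c x (mem_set cx)).
Qed.

Lemma holomorphic_continuous (W : normedModType R[i]) (f : G -> W) :
  holomorphic f -> continuous f.
Proof.
move=> hf x A fA; have [c ac cx] := @atlas_cover R G x.
have invx := @chart_funK _ _ _ c x (mem_set cx).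
have cf := differentiable_continuous (hf c ac x cx).
have fA' : nbhs ((f \o chart_inv c) (chart_fun c x)) A by rewrite /= invx.
have := @chart_fun_continuous _ _ _ c x (mem_set cx) _ (cf A fA').
by apply: filterS2 (near_chart_funK cx) => y /= invy; rewrite invy.
Qed.

(** In charts the map is [f] read in the chart [c3] at xg, composed with multiplication with its
    second argument frozen at [g]. The two agree only where the product stays in the domain of
    [c3]. *)
Lemma holomorphic_mulr (W : normedModType R[i]) (f : G -> W) (g : G) :
  holomorphic f -> holomorphic (fun x => f (x * g)%g).
Proof.
move=> hf c ac x cx.
have [c2 ac2 c2g] := @atlas_cover R G g.
have [c3 ac3 c3xg] := @atlas_cover R G (x * g)%g.
have invg := @chart_funK _ _ _ c2 g (mem_set c2g).
have invx := @chart_funK _ _ _ c x (mem_set cx).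
pose h p := chart_fun c3 (chart_inv c p * g)%g.
have dh : differentiable h (chart_fun c x).
  have dp : differentiable (fun p => (p, chart_fun c2 g)) (chart_fun c x).
    by apply: differentiable_pair => //; exact: differentiable_cst.
  have := differentiable_comp dp 
    (@lie_mul_holomorphic R G c c2 c3 ac ac2 ac3 x g cx c2g c3xg).
  by rewrite /comp /= invg.
have hx : h (chart_fun c x) = chart_fun c3 (x * g)%g by rewrite /h invx.
have dfh : differentiable ((f \o chart_inv c3) \o h) (chart_fun c x).
  by apply: differentiable_comp dh _; rewrite hx; exact: hf.
apply: near_eq_differentiable dfh.
have := near_chart_inv cx (near_mulr (near_chart_funK c3xg)).
by apply: filterS => p /= ->.
Qed.

Lemma holomorphic_mull (W : normedModType R[i]) (f : G -> W) (g : G) :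
  holomorphic f -> holomorphic (fun x => f (g * x)%g).
Proof.
move=> hf c ac x cx.
have [c2 ac2 c2g] := @atlas_cover R G g.
have [c3 ac3 c3gx] := @atlas_cover R G (g * x)%g.
have invg := @chart_funK _ _ _ c2 g (mem_set c2g).
have invx := @chart_funK _ _ _ c x (mem_set cx).
pose h p := chart_fun c3 (g * chart_inv c p)%g.
have dh : differentiable h (chart_fun c x).
  have dp : differentiable (fun p => (chart_fun c2 g, p)) (chart_fun c x).
    by apply: differentiable_pair => //; exact: differentiable_cst.
  have := differentiable_comp dp 
    (@lie_mul_holomorphic R G c2 c c3 ac2 ac ac3 g x c2g cx c3gx).
  by rewrite /comp /= invg.
have hx : h (chart_fun c x) = chart_fun c3 (g * x)%g by rewrite /h invx.
have dfh : differentiable ((f \o chart_inv c3) \o h) (chart_fun c x).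
  by apply: differentiable_comp dh _; rewrite hx; exact: hf.
apply: near_eq_differentiable dfh.
have := near_chart_inv cx (near_mull (near_chart_funK c3gx)).
by apply: filterS => p /= ->.
Qed.

Lemma hol_functions_translate (f : G -> R[i]^o) (g1 g2 : G) :
  hol_functions f ->
  hol_functions (right_translate g1 (left_translate g2 f)).
Proof.
move=> hf; apply: (@holomorphic_mulr _ (left_translate g2 f)).
exact: (@holomorphic_mull _ f).
Qed.

End Holomorphic.

(** * Piecewise constant densities *)

(** The integral of a nonnegative function is a supremum over the simple functions below it, hence
    monotone without measurability; the negative part of [f] only lowers its integral. Integrands
    can thus be bounded without proving them measurable. *)
Lemma ge0_le_integral_nonmeasurable d (T : measurableType d) (R : realType)
    (m : {measure set T -> \bar R}) (f g : T -> \bar R) :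
  (forall x, 0 <= g x)%E -> (forall x, f x <= g x)%E ->
  (\int[m]_x f x <= \int[m]_x g x)%E.
Proof.
move=> g0 fg; rewrite (ge0_integralTE m g0) integralE.
set p := (\int[m]_x f^\+ x)%E; set q := (\int[m]_x f^\- x)%E.
have q0 : (0 <= q)%E by apply: integral_ge0 => x _; exact: funeneg_ge0.
apply: (@le_trans _ _ p).
  by rewrite -[leRHS]sube0; apply: leeB.
rewrite /p ge0_integralTE; last by move=> x; exact: funepos_ge0.
apply: ge_ereal_sup => _ [h hf <-]; apply: ereal_sup_ubound; exists h => //.
by move=> x; apply: (le_trans (hf x)); rewrite funeposE ge_max fg g0.
Qed.

Section StepMeasure.
Context d (T : measurableType d) (R : realType).
Variables (D : nat -> set T) (a : nat -> R).
Hypothesis mD : forall n, measurable (D n).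
Hypothesis tD : trivIset setT D.
Hypothesis DT : \bigcup_n D n = setT.
Hypothesis a_ge0 : forall n, 0 <= a n.

Definition level (x : T) : nat := xget 0%N [set n | D n x].

Lemma levelP x : D (level x) x.
Proof.
have : (\bigcup_n D n) x by rewrite DT.
by move=> [n _ Dnx]; rewrite /level; case: xgetP => // /(_ n).
Qed.

Lemma levelE n x : D n x -> level x = n.
Proof. by move=> Dnx; apply: (tD I I); exists x; split => //; exact: levelP. Qed.

Definition step (b : nat -> R) (x : T) : R := b (level x).

Lemma measurable_step b : measurable_fun setT (step b).
Proof.
move=> _ B mB; rewrite setTI.
have -> : step b @^-1` B = \bigcup_(n in [set n | B (b n)]) D n.
  rewrite predeqE => x; split => [Bx|[n /= Bn Dnx]].
    by exists (level x) => //; exact: levelP.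
  by rewrite /step /= (levelE Dnx).
by apply: bigcup_measurable => n _; exact: mD.
Qed.

Lemma integral_step (m : {measure set T -> \bar R}) (b : nat -> R) A :
  (forall n, 0 <= b n) -> measurable A ->
  (\int[m]_(x in A) (step b x)%:E = \sum_(n <oo) (b n)%:E * m (A `&` D n))%E.
Proof.
move=> b0 mA; have AE : A = \bigcup_n (A `&` D n).
  by rewrite -setI_bigcupr DT setIT.
rewrite {1}AE ge0_integral_bigcup.
- apply: eq_eseriesr => n _; rewrite -integral_cst; last exact: measurableI.
  by apply: eq_integral => x /set_mem[_ Dnx]; rewrite /step (levelE Dnx).
- by move=> n; exact: measurableI.
- apply/measurable_EFinP; apply: measurable_funS (measurable_step b) => //.
- by move=> x _; rewrite lee_fin; exact: b0.
- exact: trivIset_setIl.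
Qed.

Variable lambda : {measure set T -> \bar R}.

(** Written as a series of scaled restrictions, it is a measure by construction;
    [step_measure_integral] recovers the density. *)
Definition step_measure : {measure set T -> \bar R} :=
  mseries (fun n => mscale (NngNum (a_ge0 n)) (mrestr lambda (mD n))) 0.

Lemma step_measureE A :
  step_measure A = (\sum_(n <oo) (a n)%:E * lambda (A `&` D n))%E.
Proof. by []. Qed.

Lemma step_measure_integral A : measurable A ->
  step_measure A = (\int[lambda]_(x in A) (step a x)%:E)%E.
Proof. by move=> mA; rewrite integral_step. Qed.

Lemma step_measure_level n : step_measure (D n) = ((a n)%:E * lambda (D n))%E.
Proof.
rewrite step_measure_integral // -integral_cst //.
by apply: eq_integral => x /set_mem Dnx; rewrite /step (levelE Dnx).
Qed.

Lemma integral_step_measure_lt_pinfty (f : T -> R) (b : nat -> R) :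
  (forall n, 0 <= b n) -> (forall n x, D n x -> f x <= b n) ->
  (\sum_(n <oo) (b n)%:E * ((a n)%:E * lambda (D n)) < +oo)%E ->
  (\int[step_measure]_x (f x)%:E < +oo)%E.
Proof.
move=> b0 fb; apply: le_lt_trans.
apply: (@le_trans _ _ (\int[step_measure]_x (step b x)%:E)%E).
  apply: ge0_le_integral_nonmeasurable => x; rewrite lee_fin; first exact: b0.
  by apply: fb; exact: levelP.
rewrite integral_step //.
apply: lee_nneseries => [n *|n _].
  by apply: mule_ge0; rewrite ?lee_fin.
by rewrite setTI step_measure_level.
Qed.

End StepMeasure.

(** * Exhaustion by double cosets *)

Section Exhaustion.
Context (R : realType) (G : complexLieGroupType R).
Implicit Types (A V K : set G) (x y k : G) (n : nat).

Fixpoint setX_pow V n : set G :=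
  if n is n'.+1 then [set a * b | a in setX_pow V n' & b in V]%g
  else [set 1%g].

Lemma compact_setX_pow V n : compact V -> compact (setX_pow V n).
Proof.
move=> cV; elim: n => [|n IH] /=; first exact: compact_set1.
exact: compact_mulset.
Qed.

Lemma setX_powD V m n x y :
  setX_pow V m x -> setX_pow V n y -> setX_pow V (m + n) (x * y)%g.
Proof.
move=> Vx; elim: n y => [|n IH] y /=; first by move=> ->; rewrite addn0 mulg1.
move=> [a Va [b Vb <-]]; rewrite addnS /=.
by exists (x * a)%g; [exact: IH|exists b; rewrite // mulgA].
Qed.

Lemma setX_pow1 V x : V x -> setX_pow V 1 x.
Proof. by move=> Vx /=; exists 1%g => //; exists x => //; rewrite mul1g. Qed.

Lemma setX_pow_le V m n : V 1%g -> (m <= n)%N ->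
  setX_pow V m `<=` setX_pow V n.
Proof.
move=> V1 mn; rewrite -(subnKC mn); elim: (n - m)%N => [|k IH] x.
  by rewrite addn0.
by move=> /IH Vx; rewrite addnS /=; exists x => //; exists 1%g; rewrite ?mulg1.
Qed.

Lemma nbhs_setX_pow V n x : nbhs 1%g V -> setX_pow V n x ->
  nbhs x (setX_pow V n.+1).
Proof.
move=> V1 Vx; have := nbhs_mull x V1; rewrite mulg1; apply: filterS.
by move=> _ [v Vv <-]; exists x => //; exists v.
Qed.

(* The union of the powers of V is open, and so is its complement. *)
Lemma connected_setX_pow V x : connected [set: G] -> nbhs 1%g V ->
  exists n, setX_pow V n x.
Proof.
move=> conG V1; pose H := \bigcup_n setX_pow V n.
have oH : open H.
  rewrite openE => y [n _ Vy]; rewrite /interior.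
  by apply: filterS (nbhs_setX_pow V1 Vy) => z Vz; exists n.+1.
have cH : closed H.
  rewrite -openC openE => y nHy; rewrite /interior.
  (* If y lies outside [H] and v^-1 is in [V], then yv lies outside [H] as well, since y = (yv)
     v^-1. *)
  have V'1 : nbhs 1%g [set v | V v^-1%g].
    by apply: (@lie_inv_continuous R G 1%g); rewrite invg1.
  have := nbhs_mull y V'1; rewrite mulg1; apply: filterS => _ [v Vv <-] [n _ Hyv].
  by apply: nHy; exists n.+1 => //=; exists (y * v)%g => //; exists v^-1%g; rewrite // mulgK.
have HT : H = [set: G].
  apply: conG; first by exists 1%g; exists 0%N.
  - by exists H; rewrite ?setTI.
  - by exists H; rewrite ?setTI.
by have [n _ Hx] : H x; [rewrite HT|exists n].
Qed.

Definition biinvariant_set K A := forall k x, K k ->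
  (A (k * x)%g <-> A x) /\ (A (x * k)%g <-> A x).

Definition double_coset K A : set G :=
  [set a * b | a in [set a * b | a in K & b in A] & b in K]%g.

Lemma compact_double_coset K A : compact K -> compact A ->
  compact (double_coset K A).
Proof. by move=> cK cA; apply: compact_mulset => //; exact: compact_mulset. Qed.

Lemma double_cosetS K A B : A `<=` B -> double_coset K A `<=` double_coset K B.
Proof.
move=> AB _ [_ [k Kk [a Aa <-]] [k' Kk' <-]].
exists (k * a)%g; last by exists k'.
by exists k => //; exists a => //; exact: AB.
Qed.

Lemma sub_double_coset K A : K 1%g -> A `<=` double_coset K A.
Proof.
move=> K1 a Aa; exists a; last by exists 1%g; rewrite ?mulg1.
by exists 1%g => //; exists a; rewrite ?mul1g.
Qed.

Lemma biinvariant_double_coset K A : compact_subgroup K ->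
  biinvariant_set K (double_coset K A).
Proof.
move=> [K1 KM KV _].
have l k x : K k -> double_coset K A x -> double_coset K A (k * x)%g.
  move=> Kk [_ [k1 Kk1 [a Aa <-]] [k2 Kk2 <-]].
  exists (k * k1 * a)%g; last by exists k2; rewrite // !mulgA.
  by exists (k * k1)%g; [exact: KM|exists a].
have r k x : K k -> double_coset K A x -> double_coset K A (x * k)%g.
  move=> Kk [_ [k1 Kk1 [a Aa <-]] [k2 Kk2 <-]].
  exists (k1 * a)%g; first by exists k1 => //; exists a.
  by exists (k2 * k)%g; [exact: KM|rewrite !mulgA].
move=> k x Kk; split; split; [| exact: l | | exact: r].
- by move/(l _ _ (KV _ Kk)); rewrite mulKg.
- by move/(r _ _ (KV _ Kk)); rewrite mulgK.
Qed.

Lemma double_coset_setX_pow K V n : K `<=` V ->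
  double_coset K (setX_pow V n) `<=` setX_pow V n.+2.
Proof.
move=> KV _ [_ [k Kk [a Aa <-]] [k' Kk' <-]]; exists (k * a)%g.
  by rewrite -[n.+1]add1n; apply: setX_powD Aa; apply/setX_pow1/KV.
by exists k' => //; exact: KV.
Qed.

Lemma biinvariant_seqD K (E : nat -> set G) n :
  (forall n, biinvariant_set K (E n)) -> biinvariant_set K (seqD E n).
Proof.
move=> EK k x Kk; case: n => [|n] /=; first exact: EK.
have [[l l'] [r r']] := EK n.+1 k x Kk; have [[l0 l0'] [r0 r0']] := EK n k x Kk.
by split; split=> -[E1 E0]; split; auto.
Qed.

Lemma mull_setI k A B : (forall x, B (k * x)%g <-> B x) ->
  [set k * a | a in A]%g `&` B = [set k * a | a in A `&` B]%g.
Proof.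
move=> kB; rewrite predeqE => x; split=> [[[a Aa <-] /kB Ba]|[a [Aa Ba] <-]].
  by exists a.
by split; [exists a|apply/kB].
Qed.

Lemma mulr_setI k A B : (forall x, B (x * k)%g <-> B x) ->
  [set a * k | a in A]%g `&` B = [set a * k | a in A `&` B]%g.
Proof.
move=> kB; rewrite predeqE => x; split=> [[[a Aa <-] /kB Ba]|[a [Aa Ba] <-]].
  by exists a.
by split; [exists a|apply/kB].
Qed.

Lemma compact_measurable A : compact A -> measurable (A : set (borel G)).
Proof.
move=> cA; rewrite -[A]setCK; apply: measurableC; apply: sub_sigma_algebra.
by rewrite /= openC; apply: compact_closed => //; exact: lie_hausdorff.
Qed.

End Exhaustion.

(** * Densities constant on the layers of a bi-invariant compact exhaustion *)

Section StepDensity.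
Context (R : realType) (G : complexLieGroupType R).
Variables (K : set G) (E : nat -> set G) (a : nat -> R).
Variable lambda : {measure set (borel G) -> \bar R}.
Hypothesis cE : forall n, compact (E n).
Hypothesis ndE : forall m n, (m <= n)%N -> E m `<=` E n.
Hypothesis KE : forall n, biinvariant_set K (E n).
Hypothesis nbhsE : forall x : G, exists n, nbhs x (E n).
Hypothesis a_gt0 : forall n, 0 < a n.
Hypothesis haar : left_haar lambda.
Hypothesis lambdaK : forall (k : G) (A : set G), K k ->
  lambda [set a * k | a in A]%g = lambda A.

Let D := (seqD E : nat -> set (borel G)).

Let mD n : measurable (D n).
Proof.
case: n => [|n]; first exact: compact_measurable (@cE 0%N).
rewrite -[D n.+1]/(E n.+1 `\` E n).
by apply: measurableD; [exact: compact_measurable (@cE n.+1)|exact: compact_measurable (@cE n)].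
Qed.

Let tD : trivIset setT D.
Proof. by apply: trivIset_seqD => m n mn; apply/subsetPset; exact: ndE. Qed.

Let DT : \bigcup_n D n = setT.
Proof.
rewrite eq_bigcup_seqD predeqE => x; split=> // _.
by have [n xE] := nbhsE x; exists n => //; exact: nbhs_singleton.
Qed.

Let a_ge0 n : 0 <= a n. Proof. exact: ltW. Qed.

Let level_le n x : E n x -> (level D x <= n)%N.
Proof.
move=> Enx; have := levelP DT x; rewrite leqNgt; case: (level D x) => // k.
by move=> [_ nE]; apply/negP => nk; apply: nE; exact: ndE Enx.
Qed.

Definition density_measure : {measure set (borel G) -> \bar R} :=
  step_measure mD a_ge0 lambda.

Lemma density_measure_tame : tame density_measure.
Proof.
exists lambda; split => //; exists (step D a); split.
- exact: measurable_step.
- by move=> x; exact: a_ge0.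
- move=> x; have [n xE] := nbhsE x.
  (* On [E n] only the levels up to n occur, so the minimum of [a] over 0, ..., n is a positive
     lower bound of the density there. *)
  have [delta delta0 adelta] : exists2 delta, 0 < delta &
      forall k, (k <= n)%N -> delta <= a k.
    elim: (n) => [|N [delta delta0 IH]].
      by exists (a 0%N) => // k; rewrite leqn0 => /eqP ->.
    exists (Num.min delta (a N.+1)); first by rewrite lt_min delta0 a_gt0.
    move=> k; rewrite leq_eqVlt ge_min => /orP[/eqP ->|]; first by rewrite lexx orbT.
    by rewrite ltnS => /IH ->.
  exists delta, (E n); split => //.
  by apply: aeW => y Ey; apply: adelta; exact: level_le.
- by move=> A mA; exact: step_measure_integral.
Qed.

(** The layers are [K]-bi-invariant, so translating by [K] commutes with intersecting with a layer,
    and the invariance of [lambda] applies term by term. *)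
Lemma density_measure_biinvariant : biinvariant K density_measure.
Proof.
have DK n : biinvariant_set K (D n) by exact: biinvariant_seqD.
move=> k A Kk mA; rewrite /density_measure !step_measureE; split.
  apply: eq_eseriesr => n _; congr (_ * _)%E.
  have -> : [set k * a | a in (A : set G)]%g `&` D n =
      [set k * a | a in (A `&` D n : set G)]%g.
    by apply: mull_setI => x; have [] := DK n k x Kk.
  by have [_ _] := haar; apply; exact: measurableI.
apply: eq_eseriesr => n _; congr (_ * _)%E.
have -> : [set a * k | a in (A : set G)]%g `&` D n =
    [set a * k | a in (A `&` D n : set G)]%g.
  by apply: mulr_setI => x; have [] := DK n k x Kk.
exact: lambdaK.
Qed.

Lemma density_measure_integral_lt_pinfty (f : borel G -> R) (b : nat -> R) :
  (forall n, 0 <= b n) -> (forall n x, E n x -> f x <= b n) ->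
  (\sum_(n <oo) (b n * a n)%:E * lambda (E n) < +oo)%E ->
  (\int[density_measure]_x (f x)%:E < +oo)%E.
Proof.
move=> b0 fb bE; apply: integral_step_measure_lt_pinfty (b0) _ _ => //.
  by move=> n x Dx; apply: fb; case: n Dx => [|n] // [].
apply: le_lt_trans bE; apply: lee_nneseries => [n *|n _].
  by apply: mule_ge0; rewrite ?lee_fin ?b0 // mule_ge0 ?lee_fin.
rewrite muleA -EFinM; apply: lee_pmul => //; first by rewrite lee_fin mulr_ge0.
apply: le_measure; [by apply: mem_set; exact: mD|apply: mem_set|].
  exact: compact_measurable (@cE n).
by case: n => [|n] // x [].
Qed.

End StepDensity.

(** * Growth bounds *)

Section MatrixBounds.
Context (R : realType).
Import ComplexField.Normc.
Implicit Types (n : nat) (r s : R).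

Lemma normc_sum (I : Type) (l : seq I) (F : I -> R[i]) :
  normc (\sum_(i <- l) F i) <= \sum_(i <- l) normc (F i).
Proof.
elim: l => [|i l IH]; first by rewrite !big_nil normc0.
rewrite !big_cons; apply: (le_trans (le_normcD _ _)).
by rewrite lerD2l.
Qed.

Lemma normc_conj (z : R[i]) : normc z^* = normc z.
Proof. by case: z => a b /=; rewrite sqrrN. Qed.

Definition entries_le n (A : 'M[R[i]^o]_n) r := forall i j, normc (A i j) <= r.

Lemma normc_sum_ord_le n (F : 'I_n -> R[i]) r :
  (forall i, normc (F i) <= r) -> normc (\sum_i F i) <= n%:R * r.
Proof.
move=> Fr; apply: (le_trans (normc_sum _ _)).
apply: (le_trans (ler_sum _ (fun i _ => Fr i))).
by rewrite sumr_const card_ord mulr_natl.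
Qed.

Lemma entries_le_mul n (A B : 'M[R[i]^o]_n) r s : entries_le A r ->
  entries_le B s -> entries_le (A *m B) (n%:R * (r * s)).
Proof.
move=> Ar Bs i j; rewrite mxE; apply: normc_sum_ord_le => k.
by rewrite normcM ler_pM ?normc_ge0.
Qed.

Lemma entries_le_bounded n (A : 'M[R[i]^o]_n) :
  exists2 r, 0 <= r & entries_le A r.
Proof.
exists (\sum_(p : 'I_n * 'I_n) normc (A p.1 p.2)).
  by apply: sumr_ge0 => p _; exact: normc_ge0.
move=> i j; rewrite (bigD1 (i, j)) //= lerDl.
by apply: sumr_ge0 => p _; exact: normc_ge0.
Qed.

Lemma hs_norm2_le n (H : 'M[R[i]^o]_n) : exists2 c, 0 <= c &
  forall A r, 0 <= r -> entries_le A r -> hs_norm2 H A <= c * r ^+ 2.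
Proof.
have [h h0 Hh] := entries_le_bounded H.
have [h' h'0 Hh'] := entries_le_bounded (invmx H).
(* Three matrix products and the trace each cost a factor n; the 1 marks a place of [r], as r^2 is
   taken out. *)
exists (n%:R * (n%:R * (n%:R * (h' * 1) * h) * n%:R)).
  by rewrite !mulr_ge0.
move=> A r r0 Ar; apply: (le_trans (Re_le_normc _)).
have As : entries_le (A ^t*) r.
  by move=> i j; rewrite !mxE normc_conj.
have HA := entries_le_mul Ar (entries_le_mul (entries_le_mul Hh' As) Hh).
apply: (le_trans (normc_sum_ord_le (fun i => HA i i))).
by rewrite le_eqVlt; apply/orP; left; apply/eqP; ring.
Qed.

End MatrixBounds.

Section CompactBounds.
Context (R : realType) (G : complexLieGroupType R).
Import ComplexField.Normc.

Lemma continuous_normc_bounded (f : G -> R[i]^o) (A : set G) :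
  continuous f -> compact A ->
  exists2 r, 0 <= r & forall x, A x -> normc (f x) <= r.
Proof.
move=> cf cA.
have cfA : compact ((fun x => normc (f x) : R^o) @` A).
  apply: continuous_compact => //; apply: continuous_subspaceT => x.
  exact: (continuous_comp (cf x) (@continuous_normc R (f x))).
have [M [_ /(_ (`|M| + 1))]] := compact_bounded cfA.
move=> /(_ (ltr_pwDr ltr01 (ler_norm M))) fM.
exists (`|M| + 1); first by rewrite addr_ge0.
by move=> x Ax; apply: (le_trans (ler_norm _)); apply: fM; exists x.
Qed.

Lemma hol_representation_bound (V : set G) n (pi : G -> 'M[R[i]^o]_n) :
  compact V -> hol_representation pi -> exists2 C, 0 <= C &
    forall k x, setX_pow V k x -> entries_le (pi x) (C ^+ k).
Proof.
move=> cV [pi1 piM hpi].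
have cpi i j : continuous (fun x => pi x i j : R[i]^o).
  move=> x A xA.
  have coordA : nbhs (pi x) [set M : 'M[R[i]^o]_n | A (M i j)].
    exists (fun i' j' => if (i' == i) && (j' == j) then A else setT).
      by move=> i' j'; case: ifP => [/andP[/eqP -> /eqP ->]//|_]; exact: filterT.
    by move=> M /(_ i j); rewrite !eqxx.
  exact: (holomorphic_continuous hpi coordA).
have /choice[c cP] : forall p : 'I_n * 'I_n, exists r : R,
    0 <= r /\ forall x, V x -> normc (pi x p.1 p.2) <= r.
  by move=> p; have [r r0 rV] := continuous_normc_bounded (cpi p.1 p.2) cV; exists r.
pose C := \sum_p c p.
have C0 : 0 <= C by apply: sumr_ge0 => p _; have [] := cP p.
have piC x : V x -> entries_le (pi x) C.
  move=> Vx i j; rewrite /C (bigD1 (i, j)) //= ler_wpDr //.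
    by apply: sumr_ge0 => p _; have [] := cP p.
  by have [_] := cP (i, j); exact.
(* Each further factor from [V] multiplies the entry bound by [C] and, through the matrix product,
   by n. *)
exists (n%:R * C) => [|k]; first by rewrite mulr_ge0.
elim: k => [|k IH] x /=.
  move=> -> i j; rewrite pi1 mxE expr0.
  by case: (i == j); rewrite ?normc1 ?normc0.
move=> [a /IH pa [b /piC pb <-]]; rewrite piM.
move=> i j; apply: (le_trans (entries_le_mul pa pb i j)).
by rewrite exprSr mulrCA.
Qed.

End CompactBounds.

(** Comparison with c times the exponential series at [x]: the factor 1 / n! beats any geometric
    growth. *)
Lemma nneseries_exp_lt_pinfty (R : realType) (u : nat -> \bar R) (c x : R) :
  0 <= c -> 0 <= x ->
  (forall n, 0 <= u n)%E -> (forall n, u n <= (c * (x ^+ n / n`!%:R))%:E)%E ->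
  (\sum_(n <oo) u n < +oo)%E.
Proof.
move=> c0 x0 u0 uc.
apply: (@le_lt_trans _ _ (\sum_(n <oo) (c * (x ^+ n / n`!%:R))%:E)%E).
  by apply: lee_nneseries.
have -> : (\sum_(n <oo) (c * (x ^+ n / n`!%:R))%:E =
    c%:E * \sum_(n <oo) (exp_coeff x n)%:E)%E.
  rewrite -nneseriesZl; last by move=> n _; rewrite lee_fin exp_coeff_ge0.
  by apply: eq_eseriesr => n _; rewrite EFinM.
suff : (\sum_(n <oo) (exp_coeff x n)%:E < +oo)%E.
  have : (0 <= \sum_(n <oo) (exp_coeff x n)%:E)%E.
    by apply: nneseries_ge0 => n _ _; rewrite lee_fin exp_coeff_ge0.
  by case: (\sum_(n <oo) _)%E => // r _ _; rewrite -EFinM ltry.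
have -> : (\sum_(n <oo) (exp_coeff x n)%:E = (expR x)%:E)%E.
  rewrite /expR -EFin_lim; last exact: is_cvg_series_exp_coeff.
  by congr (limn _); apply/funext => n; rewrite /= sumEFin.
exact: ltry.
Qed.

(** * Choice of the weights and verification of integrability *)

Theorem theorem3p2 (R : realType) (G : complexLieGroupType R)
    (F : set (G -> R[i]^o)) (K : set G) :
  connected [set: G] -> reductive G ->
  countable F -> F `<=` @hol_functions R G ->
  maximal_compact_subgroup K ->
  exists m : {measure set (borel G) -> \bar R},
    [/\ admissible K m,
        forall (g1 g2 : G) (f : G -> R[i]^o), F f ->
          HL2 m (right_translate g1 (left_translate g2 f))
      & F `<=` HL2 m].
Proof.
move=> conG _ cF Fhol [gK _]; have [K1 _ _ cK] := gK.
have [V0 cV0 V0_1] := compact_nbhs (1%g : G).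
(* Putting [K] inside [V] is what places [E n] in [P n.+2]. *)
pose V := V0 `|` K.
have cV : compact V by exact: compactU.
have nV : nbhs 1%g V by apply: filterS V0_1; exact: subsetUl.
have V1 : V 1%g by exact: nbhs_singleton.
have KV : K `<=` V by exact: subsetUr.
pose P := setX_pow V; pose E n := double_coset K (P n).
have cP n : compact (P n) by exact: compact_setX_pow.
have P_le m n : (m <= n)%N -> P m `<=` P n by exact: setX_pow_le.
have allP x : exists n, P n x by exact: connected_setX_pow.
have cE n : compact (E n) by exact: compact_double_coset.
have E_le m n : (m <= n)%N -> E m `<=` E n.
  by move=> mn; apply: double_cosetS; exact: P_le.
have EP n : E n `<=` P n.+2 by exact: double_coset_setX_pow.
have KE n : biinvariant_set K (E n) by exact: biinvariant_double_coset.
have nE (x : G) : exists n, nbhs x (E n).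
  have [n Px] := allP x; exists n.+1.
  by apply: filterS (nbhs_setX_pow nV Px); exact: sub_double_coset.
have [lambda [haar lambdaK]] := haar_measure gK cV nV.
(* Indices that code no element of [F] receive the zero function, so finite and empty [F] are
   covered as well. *)
have [e eP Fe] : exists2 e : nat -> G -> R[i]^o, forall j, continuous (e j) &
    forall f, F f -> exists j, e j = f.
  have [code codeI] := countable_injP F cF.
  have /choice[e eP] : forall j, exists g : G -> R[i]^o,
      continuous g /\ forall f, F f -> code f = j -> g = f.
    move=> j; have [[f Ff fj]|nf] := pselect (exists2 f, F f & code f = j).
      exists f; split; first exact/holomorphic_continuous/Fhol.
      by move=> f' Ff' f'j; apply: codeI; rewrite ?f'j ?fj //; exact: mem_set.
    exists (cst 0); split; first exact: cst_continuous.
    by move=> f Ff fj; case: nf; exists f.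
  exists e => [j|f Ff]; first by have [] := eP j.
  by exists (code f); have [_] := eP (code f); exact.
have /choice[M MP] : forall p : nat * nat, exists r : R, 0 <= r /\
    forall x, P p.2 x -> ComplexField.Normc.normc (e p.1 x) <= r.
  by move=> p; have [r] := continuous_normc_bounded (eP p.1) (cP p.2); exists r.
pose w n : R := 1 + \sum_(j < n.+1) M (j : nat, n + n)%N ^+ 2.
have w_ge1 n : 1 <= w n by rewrite lerDl sumr_ge0 // => j _; exact: sqr_ge0.
pose L n : R := fine (lambda (E n)).
have LE n : lambda (E n) = (L n)%:E.
  rewrite fineK // ge0_fin_numE //; have [_ lt_oo _] := haar; exact: lt_oo.
have L_ge0 n : 0 <= L n by exact: fine_ge0.
pose a n : R := (n`!%:R * (1 + L n) * w n)^-1.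
have a_gt0 n : 0 < a n.
  rewrite invr_gt0 !mulr_gt0 ?ltr0n ?fact_gt0 //.
    by rewrite ltr_pwDl.
  exact: lt_le_trans (w_ge1 n).
pose m := density_measure lambda cE a_gt0.
(* Integrability criterion: a bound c x^n [w n] on [E n] suffices, because [a n] cancels [w n] and
   [lambda (E n)] and leaves at most c x^n / n!. *)
have m_lt_oo (f : borel G -> R) b c x : 0 <= c -> 0 <= x ->
    (forall n, 0 <= b n) -> (forall n y, E n y -> f y <= b n) ->
    (forall n, b n <= c * x ^+ n * w n) -> (\int[m]_y (f y)%:E < +oo)%E.
  move=> c0 x0 b0 fb bc.
  apply: density_measure_integral_lt_pinfty (b0) fb _ => //.
  apply: (nneseries_exp_lt_pinfty c0 x0) => n; rewrite LE -EFinM lee_fin.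
    by rewrite !mulr_ge0 // ltW.
  have aL0 : 0 <= a n * L n by rewrite mulr_ge0 // ltW.
  rewrite -mulrA; apply: (le_trans (ler_wpM2r aL0 (bc n))).
  have w0 : w n != 0 by rewrite gt_eqF // (lt_le_trans _ (w_ge1 n)).
  have L1 : 0 < 1 + L n by rewrite ltr_pwDl.
  have n0 : n`!%:R != 0 :> R by rewrite pnatr_eq0 -lt0n fact_gt0.
  have -> : c * x ^+ n * w n * (a n * L n) =
      c * (x ^+ n / n`!%:R) * (L n / (1 + L n)).
    by rewrite /a; field; rewrite w0 n0 gt_eqF.
  apply: ler_piMr; first by rewrite mulr_ge0 // divr_ge0 // exprn_ge0.
  by rewrite ler_pdivrMr // mul1r lerDr.
have mHL2 (g1 g2 : G) (f : G -> R[i]^o) : F f ->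
    HL2 m (right_translate g1 (left_translate g2 f)).
  move=> Ff; split; first exact/hol_functions_translate/Fhol.
  have [j ej] := Fe f Ff.
  have [p1 Pg1] := allP g1; have [p2 Pg2] := allP g2^-1%g.
  (* For y in [E n], which lies in [P n.+2], the point g2^-1 y g1 lies in [P (q + n)]. *)
  pose q := (p2 + (2 + p1))%N.
  (* From n = [N] on, q + n is at most n + n and [e j] is among the functions counted in [w n]. The
     finitely many earlier n are absorbed by the constant [c]. *)
  pose N := maxn j q.
  pose b n : R := if (n < N)%N then M (j, q + n)%N ^+ 2 else M (j, n + n)%N ^+ 2.
  pose c : R := 1 + \sum_(n < N) M (j, q + n)%N ^+ 2.
  have c_ge1 : 1 <= c by rewrite lerDl sumr_ge0 // => n _; exact: sqr_ge0.
  apply: (m_lt_oo _ b c 1) => //; first exact: le_trans c_ge1.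
  - by move=> n; rewrite /b; case: ifP => _; exact: sqr_ge0.
  - move=> n y Ey; rewrite -[complex.Re _]/(ComplexField.Normc.normc _).
    have Py : P (q + n)%N (g2^-1 * (y * g1))%g.
      rewrite (_ : (q + n)%N = (p2 + (n.+2 + p1))%N); last by rewrite /q; lia.
      by apply: setX_powD Pg2 _; apply: setX_powD Pg1; exact: EP.
    rewrite /b /right_translate /left_translate -ej; case: ifPn => nN.
      have [M0 MPjn] := MP (j, q + n)%N.
      by rewrite ler_pXn2r ?nnegrE ?normc_ge0 //; exact: MPjn.
    have [M0 MPjn] := MP (j, n + n)%N.
    rewrite ler_pXn2r ?nnegrE ?normc_ge0 //; apply: MPjn => /=.
    by apply: P_le Py; move: nN; rewrite /N; lia.
  - move=> n; rewrite expr1n mulr1 /b; case: ifPn => nN.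
      apply: (@le_trans _ _ c); last by rewrite ler_peMr // (le_trans _ c_ge1).
      rewrite /c (bigD1 (Ordinal nN)) //= addrCA lerDl addr_ge0 //.
      by apply: sumr_ge0 => i _; exact: sqr_ge0.
    have jn : (j < n.+1)%N by move: nN; rewrite /N; lia.
    apply: (@le_trans _ _ (w n)).
      rewrite /w (bigD1 (Ordinal jn)) //= addrCA lerDl addr_ge0 //.
      by apply: sumr_ge0 => i _; exact: sqr_ge0.
    by rewrite ler_peMl // (le_trans _ (w_ge1 n)).
exists m; split => //.
- split.
  + exact: density_measure_tame.
  + exact: density_measure_biinvariant.
  + move=> n pi H hpi _ _ _; rewrite /hs_integral.
    have [C C0 piC] := hol_representation_bound cV hpi.
    have [h h0 Hh] := hs_norm2_le H.
    (* On [E k], inside [P k.+2], the entries are at most C^(k+2); the square C^(2k+4) is C^4 times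
       (C^2)^k. *)
    apply: (m_lt_oo _ (fun k => h * (C ^+ k.+2) ^+ 2) (h * C ^+ 4) (C ^+ 2)).
    * by rewrite mulr_ge0 // exprn_ge0.
    * exact: sqr_ge0.
    * by move=> k; rewrite mulr_ge0 // sqr_ge0.
    * move=> k y /EP Py; apply: Hh; first exact: exprn_ge0.
      exact: piC.
    * move=> k; rewrite -[leLHS]mulr1.
      rewrite (_ : h * C ^+ 4 * (C ^+ 2) ^+ k = h * (C ^+ k.+2) ^+ 2).
        by rewrite ler_wpM2l // mulr_ge0 // sqr_ge0.
      by rewrite -mulrA; congr (_ * _); rewrite -!exprM -exprD; congr (_ ^+ _); lia.
- move=> f Ff; have := mHL2 1%g 1%g f Ff.
  suff -> : right_translate 1%g (left_translate 1%g f) = f by [].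
  by apply/funext => x; rewrite /right_translate /left_translate invg1 mul1g mulg1.
Qed.
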